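(* For every $n\ge1$, $$\mathrm{QFl}_n=\bigcap_{\sigma\in S_n\setminus \mathrm{NC}_n}\{\mathrm{Pl}_\sigma=0\}\subset \mathrm{Fl}_n,$$ where $\mathrm{QFl}_n$ is the quasisymmetric flag variety, $\mathrm{NC}_n\subset S_n$ is the set of noncrossing partitions and $[\mathrm{Pl}_\sigma]_{\sigma\in S_n}$ are the Plücker functions on $\mathrm{Fl}_n$.
   Context: Work over $\mathbb{C}$. $\mathrm{Fl}_m=\mathrm{GL}_m/B_m$ ($B_m$ upper triangular) is the variety of complete flags in $\mathbb{C}^m$, with $hB_m$ corresponding to the flag whose $j$th subspace is the span of the first $j$ columns of $h$; $e_1,\dots,e_m$ is the standard basis. Plücker functions: for $\sigma\in S_n$ and $h\in \mathrm{GL}_n$, $\mathrm{Pl}_\sigma(h)=\prod_{k=1}^n\det h_{\sigma(1),\dots,\sigma(k)}$, where $h_{i_1,\dots,i_k}$ is the submatrix of $h$ with columns $1,\dots,k$ and rows $i_1,\dots,i_k$. Together they define a map $\mathrm{Fl}_n\to\mathbb{P}^{n!-1}$, so the vanishing of $\mathrm{Pl}_\sigma$ is well defined on $\mathrm{Fl}_n$. Noncrossing partitions: $w\in S_n$ lies in $\mathrm{NC}_n$ if every cycle of its disjoint cycle decomposition has the form $(b_1\,b_2\cdots b_r)$ with $b_1>b_2>\cdots>b_r$, and the underlying sets of the cycles (fixed points included) form a noncrossing set partition of $\{1,\dots,n\}$, i.e. there are no distinct $a,b$ in one block and distinct $c,d$ in another block with $a<c<b<d$. Quasisymmetric flag variety: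 let $\epsilon_i:\mathbb{C}^{m-1}\to\mathbb{C}^m$ insert a $0$ as the $i$th coordinate. For $Z\subset \mathrm{Fl}_{m-1}$ and $1\le i\le m-1$, let $\mathbb{P}_iZ\subset \mathrm{Fl}_m$ be the set of all flags $\mathcal{G}$ for which there is $\mathcal{F}\in Z$ with $\mathcal{G}_j=\epsilon_i(\mathcal{F}_j)$ for $j<i$ and $\mathcal{G}_j=\epsilon_i(\mathcal{F}_{j-1})\oplus\langle e_i\rangle$ for $j>i$ (with $\mathcal{G}_i$ arbitrary between $\mathcal{G}_{i-1}$ and $\mathcal{G}_{i+1}$). Then $\mathrm{QFl}_n=\bigcup_{T}X(T)$, the union over planar binary trees $T$ with $n$ leaves, where $X(T)=\mathbb{P}_{i_{n-1}}\cdots\mathbb{P}_{i_1}\mathrm{Fl}_1$ for any sequence $(i_1,\dots,i_{n-1})$, $1\le i_j\le j$, such that $T$ is built from the one-leaf tree by successively replacing the $i_j$th leaf by a node with two leaf children. Equivalently $\mathrm{QFl}_n$ is the union of $\mathbb{P}_{i_{n-1}}\cdots\mathbb{P}_{i_1}\mathrm{Fl}_1$ over all sequences with $1\le i_j\le j$. *)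

(* Defs.v *)
From HB Require Import structures.
From mathcomp Require Import all_boot all_order all_fingroup all_algebra.
From mathcomp Require Import classical_sets reals complex.

Set Implicit Arguments.
Unset Strict Implicit.
Unset Printing Implicit Defensive.
Import GRing.Theory.
Local Open Scope ring_scope.
Local Open Scope classical_set_scope.

Definition is_flag (K : fieldType) (m : nat)
    (F : {ffun 'I_m.+1 -> {vspace 'cV[K]_m}}) : bool :=
  [forall j : 'I_m.+1, \dim (F j) == j]
  && [forall j : 'I_m.+1, forall k : 'I_m.+1, (j <= k)%N ==> (F j <= F k)%VS].

(* Complete flags F_0 < F_1 < ... < F_m of K^m, including F_0 = 0 and F_m = K^m. *)
Record flag (K : fieldType) (m : nat) := Flag {
  flag_val : {ffun 'I_m.+1 -> {vspace 'cV[K]_m}};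
  flag_valP : is_flag flag_val }.

HB.instance Definition _ (K : fieldType) (m : nat) :=
  [isSub for @flag_val K m].

(* F_j; only meant for j <= m. *)
Definition flag_nth (K : fieldType) (m : nat) (F : flag K m) (j : nat) :
    {vspace 'cV[K]_m} :=
  flag_val F (inord j).

(* The coset h B_m is the flag F. *)
Definition represents (K : fieldType) (m : nat) (h : 'M[K]_m) (F : flag K m) :
    Prop :=
  h \in unitmx /\
  forall j, (j <= m)%N ->
    flag_nth F j = <<[seq col k h | k : 'I_m <- enum 'I_m & (k < j)%N]>>%VS.

(* The factor indexed by k : 'I_n is the minor with k.+1 rows and columns. *)
Definition Pl (K : fieldType) (n : nat) (s : 'S_n) (h : 'M[K]_n) : K :=
  \prod_(k < n) \det (\matrix_(a < k.+1, b < k.+1)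
    h (s (widen_ord (ltn_ord k) a)) (widen_ord (ltn_ord k) b)).

(* Independent of the representative of the flag, see Pl_zeroE. *)
Definition Pl_zero (K : fieldType) (n : nat) (s : 'S_n) : set (flag K n) :=
  [set F | exists2 h, represents h F & Pl s h = 0].

(* As a list, a cycle (b_1 b_2 ... b_r) sends b_1 to b_2, ..., b_r to b_1. *)
Definition decreasing_cycles (n : nat) (w : 'S_n) : Prop :=
  forall B, B \in porbits w ->
    exists b : seq 'I_n,
      [/\ sorted (fun x y : 'I_n => (y < x)%N) b, b =i B & fcycle w b].

Definition noncrossing (n : nat) (P : {set {set 'I_n}}) : Prop :=
  forall B C, B \in P -> C \in P -> B != C ->
    ~ exists a b c d : 'I_n,
        [/\ a \in B, b \in B, c \in C & d \in C] /\ [/\ a < c, c < b & b < d]%N.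

(* [porbits w] is the set of supports of the cycles of w, singletons included. *)
Definition NC (n : nat) : set 'S_n :=
  [set w | decreasing_cycles w /\ noncrossing (porbits w)].
Arguments NC : clear implicits.

Definition ins0 (K : fieldType) (m : nat) (i : 'I_m.+1) (v : 'cV[K]_m) :
    'cV[K]_m.+1 :=
  \col_j (if unlift i j is Some j' then v j' 0 else 0).

Lemma ins0_is_linear (K : fieldType) (m : nat) (i : 'I_m.+1) :
  linear (@ins0 K m i).
Proof.
move=> a u v; apply/colP => j; rewrite !mxE; case: unlift => [j'|].
  by rewrite !mxE.
by rewrite mulr0 addr0.
Qed.

HB.instance Definition _ (K : fieldType) (m : nat) (i : 'I_m.+1) :=
  GRing.isLinear.Build K 'cV[K]_m 'cV[K]_m.+1 *:%R (@ins0 K m i)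
    (@ins0_is_linear K m i).

(* P_i Z, for 1 <= i <= m: the position i is counted from 1, so that
   the i-th coordinate has index i.-1. *)
Definition Pop (K : fieldType) (m : nat) (i : nat) (Z : set (flag K m)) :
    set (flag K m.+1) :=
  let p : 'I_m.+1 := inord i.-1 in
  [set G | exists2 F, Z F &
     (forall j, (j < i)%N ->
        flag_nth G j = (linfun (ins0 p) @: flag_nth F j)%VS) /\
     (forall j, (i < j <= m.+1)%N ->
        flag_nth G j =
          (linfun (ins0 p) @: flag_nth F j.-1 + <[delta_mx p ord0]>)%VS)].

(* A sequence (i_1, ..., i_(n-1)) is given as a function on nat, of which only
   the values at 1, ..., n-1 matter. *)
Definition admissible (n : nat) (i : nat -> nat) : Prop :=
  forall j, (1 <= j < n)%N -> (1 <= i j <= j)%N.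

(* P_(i_(n-1)) ... P_(i_1) Fl_1; the value at n = 0 is irrelevant. *)
Fixpoint iter_Pop (K : fieldType) (i : nat -> nat) (n : nat) : set (flag K n) :=
  match n with
  | 0 => set0
  | m.+1 => if m == 0%N then setT else Pop (i m) (@iter_Pop K i m)
  end.
Arguments iter_Pop : clear implicits.

Inductive bintree : Type := Leaf | Node of bintree & bintree.

Fixpoint leaves (T : bintree) : nat :=
  if T is Node l r then (leaves l + leaves r)%N else 1%N.

(* Replace the i-th leaf (from the left, counted from 1) by a node with two
   leaf children. *)
Fixpoint graft (i : nat) (T : bintree) : bintree :=
  match T with
  | Leaf => Node Leaf Leaf
  | Node l r => if (i <= leaves l)%N then Node (graft i l) r
                else Node l (graft (i - leaves l) r)
  end.

(* The tree with n leaves built by the sequence (i_1, ..., i_(n-1)). *)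
Fixpoint grow (i : nat -> nat) (n : nat) : bintree :=
  match n with
  | 0 => Leaf
  | m.+1 => if m == 0%N then Leaf else graft (i m) (grow i m)
  end.

(* X(T), for T with n leaves; all sequences building T give the same set. *)
Definition X_tree (K : fieldType) (n : nat) (T : bintree) : set (flag K n) :=
  [set F | exists i, [/\ admissible n i, grow i n = T & iter_Pop K i n F]].
Arguments X_tree : clear implicits.

Definition QFl (K : fieldType) (n : nat) : set (flag K n) :=
  \bigcup_(T in [set T | leaves T = n]) X_tree K n T.
Arguments QFl : clear implicits.

Lemma leaves_graft i T : leaves (graft i T) = (leaves T).+1.
Proof.
elim: T i => [//|l IHl r IHr] i /=.
by case: ifP => _ /=; rewrite ?IHl ?IHr ?addnS.
Qed.

Lemma leaves_grow i n : (0 < n)%N -> leaves (grow i n) = n.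
Proof.
case: n => // n _; elim: n => [//|n IHn].
by rewrite [grow _ _]/= leaves_graft -[leaves _]/(leaves (grow i n.+1)) IHn.
Qed.

Lemma QFlE (K : fieldType) (n : nat) : (0 < n)%N ->
  QFl K n = \bigcup_(i in [set i | admissible n i]) iter_Pop K i n.
Proof.
move=> n_gt0; apply/seteqP; split=> [F [T _ [i [ai _ Fi]]] | F [i ai Fi]].
  by exists i.
by exists (grow i n) => /=; [exact: leaves_grow | exists i].
Qed.

Lemma dim_flag_nth (K : fieldType) (m : nat) (F : flag K m) (j : nat) :
  (j <= m)%N -> \dim (flag_nth F j) = j.
Proof.
move=> jm; have /andP[/forallP/(_ (inord j))/eqP dF _] := flag_valP F.
by rewrite /flag_nth dF inordK.
Qed.

Lemma flag_nthS (K : fieldType) (m : nat) (F : flag K m) (j k : nat) :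
  (j <= k <= m)%N -> (flag_nth F j <= flag_nth F k)%VS.
Proof.
move=> /andP[jk km]; have /andP[_ /forallP/(_ (inord j))/forallP/(_ (inord k))/implyP] := flag_valP F.
rewrite /flag_nth => -> //.
by rewrite !inordK // ltnS (leq_trans jk).
Qed.

Lemma mem_span_colP (K : fieldType) (m j : nat) (h : 'M[K]_m) (v : 'cV[K]_m) :
  reflect (exists c : 'cV[K]_m,
             (forall k : 'I_m, (j <= k)%N -> c k 0 = 0) /\ v = h *m c)
    (v \in <<[seq col k h | k : 'I_m <- enum 'I_m & (k < j)%N]>>%VS).
Proof.
have colsum (c : 'cV[K]_m) : h *m c = \sum_k c k 0 *: col k h.
  apply/colP => r; rewrite mxE summxE; apply: eq_bigr => k _.
  by rewrite !mxE mulrC.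
apply: (iffP idP) => [|[c [c0 ->]]]; last first.
  rewrite colsum; apply: memv_suml => k _; have [kj|jk] := ltnP k j.
    apply/memvZ/memv_span/mapP; exists k => //.
    by rewrite mem_filter kj mem_enum.
  by rewrite c0 // scale0r mem0v.
rewrite span_def big_map big_filter big_enum_cond /=.
move=> /memv_sumP[u uP ->].
have /fin_all_exists[c cP] : forall k : 'I_m,
    exists a : K, ((k < j)%N -> u k = a *: col k h) /\ ((j <= k)%N -> a = 0).
  move=> k; have [kj|jk] := ltnP k j.
    by have /vlineP[a ->] := uP k kj; exists a.
  by exists 0; split.
exists (\col_k c k); split=> [k jk|]; first by rewrite mxE (cP k).2.
rewrite colsum [RHS](bigID (fun k : 'I_m => (k < j)%N)) /=.
rewrite [X in _ + X]big1 ?addr0.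
  by apply: eq_bigr => k kj; rewrite mxE (cP k).1.
by move=> k; rewrite -leqNgt => jk; rewrite mxE (cP k).2 // scale0r.
Qed.

Lemma represents_exists_mx (K : fieldType) (m : nat) (F : flag K m) :
  exists h, represents h F.
Proof.
have /fin_all_exists[v vP] : forall k : 'I_m, exists v : 'cV[K]_m,
    v \in flag_nth F k.+1 /\ v \notin flag_nth F k.
  move=> k; have : ~~ (flag_nth F k.+1 <= flag_nth F k)%VS.
    apply/negP => /dimvS; rewrite !dim_flag_nth ?ltnn //; exact: ltnW.
  by case/subvPn => v v1 v2; exists v.
pose h : 'M[K]_m := \matrix_(r, k) v k r 0.
have colh k : col k h = v k by apply/colP => r; rewrite !mxE.
have spanh j : (j <= m)%N ->
    flag_nth F j = <<[seq col k h | k : 'I_m <- enum 'I_m & (k < j)%N]>>%VS.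
  elim: j => [_|j IHj jm].
    apply/eqP; rewrite (eq_filter (a2 := pred0)) // filter_pred0 span_nil.
    by rewrite -dimv_eq0 dim_flag_nth.
  set S := <<_>>%VS.
  have SF : (S <= flag_nth F j.+1)%VS.
    apply/span_subvP => u /mapP[k]; rewrite mem_filter ltnS => /andP[kj _] ->.
    by rewrite colh; apply: subvP (vP k).1; apply: flag_nthS; rewrite ltnS kj.
  have FS : (flag_nth F j <= S)%VS.
    rewrite IHj 1?ltnW //; apply: sub_span => u /mapP[k].
    rewrite mem_filter => /andP[kj _] ->; apply: map_f.
    by rewrite mem_filter mem_enum ltnW.
  apply/esym/eqP; rewrite eqEdim SF /= dim_flag_nth // ltnNge.
  apply/negP => dS; have /eqP FES : flag_nth F j == S.
    by rewrite eqEdim FS dim_flag_nth // ltnW.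
  have := (vP (Ordinal jm)).2; rewrite /= FES -colh => /negP; apply.
  by apply/memv_span/map_f; rewrite mem_filter mem_enum /= ltnSn.
exists h; split=> //.
have Ffull : flag_nth F m = fullv.
  by apply/eqP; rewrite eqEdim subvf dimvf dim_flag_nth ?leqnn // /dim /= muln1.
have /fin_all_exists[c cP] : forall k : 'I_m,
    exists c : 'cV[K]_m, delta_mx k 0 = h *m c.
  move=> k; have : delta_mx k 0 \in flag_nth F m by rewrite Ffull memvf.
  by rewrite spanh // => /mem_span_colP[c [_ ->]]; exists c.
suff hc : h *m (\matrix_(r, k) c k r 0) = 1%:M by have [] := mulmx1_unit hc.
apply/matrixP => r k; have /matrixP/(_ r 0) := cP k.
rewrite !mxE eqxx andbT => ->; apply: eq_bigr => l _.
by rewrite [X in _ * X]mxE.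
Qed.

Lemma represents_exists_flag (K : fieldType) (m : nat) (h : 'M[K]_m) :
  h \in unitmx -> exists F : flag K m, represents h F.
Proof.
move=> hu; pose S j := <<[seq col k h | k : 'I_m <- enum 'I_m & (k < j)%N]>>%VS.
have SS j k : (j <= k)%N -> (S j <= S k)%VS.
  move=> jk; apply: sub_span => u /mapP[l]; rewrite mem_filter => /andP[lj _] ->.
  by apply: map_f; rewrite mem_filter mem_enum (leq_trans lj).
have notS (k : 'I_m) : col k h \notin S k.
  apply/negP => /mem_span_colP[c [c0 hc]].
  have : delta_mx k 0 = c by apply: (can_inj (mulKmx hu)); rewrite -colE.
  by move/colP/(_ k)/eqP; rewrite c0 // mxE !eqxx oner_eq0.
have inS (k : 'I_m) : col k h \in S k.+1.
  by apply/memv_span/map_f; rewrite mem_filter mem_enum /= ltnSn.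
have dimS j : (j <= m)%N -> \dim (S j) = j.
  elim: j => [_|j IHj jm].
    by rewrite /S (eq_filter (a2 := pred0)) // filter_pred0 span_nil dimv0.
  have IH := IHj (ltnW jm); apply/eqP; rewrite eqn_leq; apply/andP; split.
    have -> : S j.+1 = (S j + <[col (Ordinal jm) h]>)%VS.
      apply/eqP; rewrite eqEsubv subv_add SS // -memvE (inS (Ordinal jm)) !andbT.
      apply/span_subvP => u /mapP[k]; rewrite mem_filter ltnS leq_eqVlt.
      move=> /andP[/orP[/eqP kj|kj] _] ->.
        have -> : k = Ordinal jm by exact: val_inj.
        exact: (subvP (addvSr _ _)) (memv_line _).
      apply: (subvP (addvSl _ _)); apply/memv_span/map_f.
      by rewrite mem_filter mem_enum kj.
    apply: leq_trans (dimv_add_leqif _ _) _.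
    by rewrite IH dim_vline -[j.+1]addn1 leq_add2l leq_b1.
  rewrite ltnNge; apply/negP => dS.
  have /eqP ES : S j == S j.+1 by rewrite eqEdim SS // IH.
  by have := notS (Ordinal jm); rewrite /= ES (inS (Ordinal jm)).
have Fl : is_flag [ffun j : 'I_m.+1 => S j].
  apply/andP; split; first by apply/forallP => j; rewrite ffunE dimS // -ltnS.
  apply/forallP => j; apply/forallP => k; rewrite !ffunE.
  by apply/implyP => /SS.
exists (Flag Fl); split=> // j jm.
by rewrite /flag_nth /= ffunE inordK.
Qed.

Lemma Pl_zeroE (K : fieldType) (n : nat) (s : 'S_n) (h : 'M[K]_n)
    (F : flag K n) :
  represents h F -> Pl_zero s F <-> Pl s h = 0.
Proof.
suff main g : represents g F -> represents h F -> Pl s g = 0 -> Pl s h = 0.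
  by move=> hF; split=> [[g gF g0]|h0]; [exact: (main g) | exists h].
move=> [_ gF] [_ hF] /eqP/prodf_eq0[k _ /eqP gk0].
apply/eqP/prodf_eq0; exists k => //; apply/eqP.
set w := widen_ord (ltn_ord k).
have /fin_all_exists[c cP] : forall b : 'I_k.+1, exists c : 'cV[K]_n,
    (forall l : 'I_n, (k.+1 <= l)%N -> c l 0 = 0) /\ col (w b) h = g *m c.
  move=> b; apply/mem_span_colP; rewrite -gF // hF //.
  by apply/memv_span/map_f; rewrite mem_filter mem_enum /= ltn_ord.
suff -> : \matrix_(a < k.+1, b < k.+1) h (s (w a)) (w b)
    = (\matrix_(a < k.+1, b < k.+1) g (s (w a)) (w b))
      *m (\matrix_(a < k.+1, b < k.+1) c b (w a) 0).
  by rewrite det_mulmx gk0 mul0r.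
apply/matrixP => a b; rewrite !mxE.
have /colP/(_ (s (w a))) := (cP b).2; rewrite !mxE => ->.
rewrite (bigID (fun l : 'I_n => (l < k.+1)%N)) /= [X in _ + X]big1 ?addr0.
  rewrite (big_ord_narrow (ltn_ord k)) /=.
  by apply: eq_bigr => l _; rewrite !mxE.
by move=> l; rewrite -leqNgt => kl; rewrite (cP b).1 // mulr0.
Qed.

(* Main.v *)
Require Import Defs.
From mathcomp Require Import all_boot all_order all_fingroup all_algebra.
From mathcomp Require Import classical_sets reals complex.
From mathcomp Require Import zify.

(** The equality holds over every field, and the proof is matroid theory.

    Fix a flag F.  The minors in Pl_s are all nonzero exactly when, for every
    k, a vector of F_k is determined by its coordinates s(0), ..., s(k-1); such
    an s is called a chain of F below, because its initial segments form a
    maximal chain of bases of the matroids of F_1, ..., F_n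
    ([Pl_neq0_chain]).  The theorem says that F lies in QFl_n if and only if
    all its chains are noncrossing partitions.

    On the permutation side, thicken every point x of the circle to the two
    points 2x and 2x+1, and join 2x to 2w(x)+1.  Then w is a noncrossing
    partition if and only if this perfect matching of 2n points has no crossing
    chords ([NC_ncmatching], [ncmatching_NC]).  This turns the global conditions
    on the cycles of w into conditions on pairs of points, and it makes plain
    that inserting or removing a chord between two neighbouring points changes
    nothing ([ncmatching_delete]).  Such a chord corresponds to a value p with
    w(p) = p or w(p+1) = p.

    If G is obtained from F by the operation P_(p+1), then F_k has no p-th
    coordinate for k <= p and contains e_p for k >= p+2; hence every chain of G
    takes the value p at p or at p+1, and removing the value p gives a chain of
    F ([extends_short_chord], [chain_delete]).  Conversely each chain of F comes
    in this way from a chain of G ([chain_lift]).  So induction on n gives that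
    the chains of points of QFl_n are noncrossing, and gives the converse as
    soon as a flag F all of whose chains are noncrossing is known to have the
    form P_(p+1) of something, that is: for some p < n-1, F_p lies in
    the hyperplane x_p = 0 and F_(p+2) contains e_p ([exists_deletable],
    [delete_flag]).

    The existence of p is the heart of the matter.  Take p least with
    e_p in F_(p+2); p = n-2 is always a candidate.  If F_p is not in the
    hyperplane x_p = 0, there is some k < p with F_k in x_k = 0 but F_(k+1) not
    in x_(k+1) = 0, while e_k is not in F_(k+2).  The greedy
    algorithm which takes the coordinate k+1 as early and the coordinate k as
    late as possible ([greedy_chain]) yields a chain s whose inverse sends k+1
    to some y <= k and k to some x >= k+2.  The chords at x and y cross, so s is
    not noncrossing. *)

Set Implicit Arguments.
Unset Strict Implicit.
Unset Printing Implicit Defensive.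
Import GRing.Theory.

(** * Noncrossing partitions as noncrossing matchings *)

(** Of the endpoints 2y and 2wy+1 of the chord at y, exactly one lies strictly
    between the endpoints 2x and 2wx+1 of the chord at x.  For nonnegative
    integers 2x < 2y < 2wx+1 means x < y <= wx, and so on. *)
Definition chord_separates (x wx y wy : nat) : bool :=
  if x <= wx then (x < y <= wx) != (x <= wy < wx)
  else (wx < y < x) != (wx < wy < x).

Definition ncmatching n (w : 'S_n) : bool :=
  [forall x : 'I_n, forall y : 'I_n,
     (x != y) ==> ~~ chord_separates x (w x) y (w y)].

Lemma ncmatchingP n (w : 'S_n) :
  reflect (forall x y : 'I_n, x != y -> ~~ chord_separates x (w x) y (w y))
          (ncmatching w).
Proof.
apply: (iffP forallP) => [H x y xy|H x].
  by have /forallP/(_ y)/implyP := H x; apply.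
by apply/forallP => y; apply/implyP; apply: H.
Qed.

(** Going down around the circle from x, the first point of its orbit that one
    meets is w x.  When x <= w x, the way passes through 0, so x is the least
    and w x the greatest point of the orbit. *)
Definition cyclically_decreasing n (w : 'S_n) : Prop :=
  forall x z, z \in porbit w x ->
    if x <= w x then (x <= z <= w x)%N else ~~ (w x < z < x).

Lemma porbit_ind n (w : 'S_n) (P : 'I_n -> Prop) x :
  P x -> (forall z, z \in porbit w x -> P z -> P (w z)) ->
  forall z, z \in porbit w x -> P z.
Proof.
move=> P0 PS z /porbitP[k ->]; elim: k => [|k IHk]; first by rewrite expg0 perm1.
by rewrite expgSr permM; apply: PS (mem_porbit _ _ _) IHk.
Qed.

Lemma porbit_image n (w : 'S_n) x z : (w z \in porbit w x) = (z \in porbit w x).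
Proof.
have /eqP E : porbit w (w z) == porbit w z.
  by rewrite eq_porbit_mem (mem_porbit w 1 z).
by rewrite -eq_porbit_mem E eq_porbit_mem.
Qed.

(** The points 2z and 2z+1 are neighbours, so they lie on the same side of the
    chord at x unless z is x or w x.  Following the orbit from w x one stays on
    the side on which one starts, until x is reached. *)
Lemma ncmatching_cyclically_decreasing n (w : 'S_n) :
  ncmatching w -> cyclically_decreasing w.
Proof.
move=> /ncmatchingP Mw x; apply: porbit_ind => [|z _].
  by clear; case: ifP => //; lia.
have [<- _|xz] := eqVneq x z; first by clear; case: ifP; lia.
have := Mw x z xz; rewrite /chord_separates.
have : w z != w x by rewrite (inj_eq perm_inj) eq_sym.
rewrite -val_eqE /=; move: xz; rewrite -val_eqE /=.
by clear; case: ifP; lia.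
Qed.

(** If a < c < b < d with a, b in B and c, d in C, the least element x > c of B
    has w x < c, so the chord at x has c inside and d outside.  But an orbit
    other than that of x stays on one side of this chord. *)
Lemma ncmatching_noncrossing n (w : 'S_n) :
  ncmatching w -> noncrossing (porbits w).
Proof.
move=> Mw B C /imsetP[b0 _ ->] /imsetP[c0 _ ->] BC.
case=> a [b [c [d [[aB bB cC dC] [ac cb bd]]]]].
have disj z : z \in porbit w b0 -> z \in porbit w c0 -> False.
  rewrite -!eq_porbit_mem => /eqP zb /eqP zc.
  by move/eqP: BC; apply; rewrite -zb -zc.
pose P := [pred z : 'I_n | (z \in porbit w b0) && (c < z)].
have Pb : P b by rewrite /= bB.
case: (arg_minnP (fun z : 'I_n => z : nat) Pb) => x /andP[xB cx] xmin.
have xb := xmin b Pb.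
have wxB : w x \in porbit w b0 by rewrite porbit_image.
have ax : a \in porbit w x.
  by move: xB; rewrite -eq_porbit_mem => /eqP ->.
have DCx := ncmatching_cyclically_decreasing Mw ax.
have wxx : w x < x by move: DCx ac cx; clear; case: ifP; lia.
have wxc : w x < c.
  have := xmin (w x); rewrite /P /= wxB /=; case: ltngtP => // [_|/val_inj wxc].
    by move/(_ isT); move: wxx; clear; lia.
  by case: (disj (w x)) => //; rewrite -wxc.
have cd : d \in porbit w c by move: cC dC; rewrite -!eq_porbit_mem => /eqP-> /eqP->.
(* d is reached from c by iterating w, without crossing the chord at x. *)
suff : w x < d < x by move: xb bd; clear; lia.
move: d cd {dC bd}; apply: porbit_ind => [|z zc]; first by move: wxc cx; clear; lia.
have xz : x != z.
  apply/eqP => xz; apply: (disj z); first by rewrite -xz.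
  by move: cC zc; rewrite -!eq_porbit_mem => /eqP<- /eqP->.
have := (ncmatchingP _ Mw) x z xz; rewrite /chord_separates.
by move: wxx; clear; case: ifP; lia.
Qed.

Lemma cyclically_decreasing_cycles n (w : 'S_n) :
  cyclically_decreasing w -> decreasing_cycles w.
Proof.
move=> Dw B /imsetP[b0 _ ->].
case: (arg_maxnP (fun z : 'I_n => z : nat) (porbit_id w b0)) => M MB Mmax.
have BM : porbit w b0 = porbit w M by apply/eqP; rewrite eq_sym eq_porbit_mem.
rewrite BM; have orbE : fingraph.orbit w M =i porbit w M.
  move=> z; rewrite -fconnect_orbit; apply/idP/idP => [/iter_findex <-|].
    by rewrite -permX mem_porbit.
  by move/porbitP => [k ->]; rewrite permX fconnect_iter.
exists (fingraph.orbit w M); split=> //; last exact: (cycle_orbit perm_inj).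
apply/(sortedP M) => k; rewrite size_orbit => kM.
rewrite /fingraph.orbit (nth_traject _ (ltnW kM)) (nth_traject _ kM) /=.
set x := iter k w M; case: (ltnP (w x) x) => // xwx.
have xM : x \in porbit w M by rewrite /x -permX mem_porbit.
have := Dw x M; rewrite porbit_sym xM xwx /= => /(_ isT) /andP[_ Mwx].
have wxM : w x = M.
  apply/val_inj/eqP; rewrite eqn_leq Mwx andbT; apply: Mmax.
  by have : w x \in porbit w b0 by rewrite BM porbit_image.
have /eqP := findex_iter kM; rewrite iterS -/x wxM.
by have := findex0 w M => ->.
Qed.

(** The successor of x in a decreasing list is the next smaller element, and
    the successor of the last element is the first. *)
Lemma decreasing_cycles_cyclically n (w : 'S_n) :
  decreasing_cycles w -> cyclically_decreasing w.
Proof.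
move=> Dw x z zx.
have [|b [sb bE cb]] := Dw (porbit w x); first exact: imset_f.
have gtT : transitive (fun x y : 'I_n => y < x) by move=> ? ? ? /=; lia.
move: zx; have := porbit_id w x; rewrite -!bE => xb.
case/splitPr: xb sb cb {bE} => b1 b2.
rewrite (sorted_pairwise gtT) pairwise_cat /=.
case/and4P=> /allrelP H12 p1 /allP Hx p2 cb.
have wx : w x = head (head x b1) b2.
  case: b1 {p1 H12} cb => [|y b1] /=; case: b2 Hx p2 => [|y2 b2] //= Hx p2.
  - by rewrite andbT => /eqP.
  - by case/andP => /eqP.
  - by rewrite rcons_cat cat_path /= => /and3P[_ _ /andP[/eqP]].
  - by rewrite rcons_cat cat_path /= => /and4P[_ _ /eqP].
rewrite mem_cat inE wx => zb; move: H12 Hx p2.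
case: b2 {wx cb} zb => [|y b2] /= zb H12 Hx p2; last first.
  have yx := Hx y (mem_head _ _); rewrite leqNgt yx /=.
  case/or3P: zb => [zb1|/eqP->|]; last rewrite inE => /orP[/eqP->|zb2].
  - by have := H12 z x zb1 (mem_head _ _); clear; lia.
  - by clear; lia.
  - by clear; lia.
  - by case/andP: p2 => /allP/(_ z zb2); clear; lia.
have H z1 : z1 \in b1 -> x < z1 by move=> zb1; apply: (H12 _ x zb1 (mem_head _ _)).
move: H p1 zb {H12}; rewrite orbF; case: b1 => [|y b1] H /=.
  by move=> _ /eqP->; rewrite leqnn.
have xy := H y (mem_head _ _); rewrite (ltnW xy) inE.
case/andP => /allP py _ /orP[/orP[/eqP->|zb]|/eqP->].
- by rewrite (ltnW xy) leqnn.
- by have := py z zb; have := H z; rewrite inE zb orbT => /(_ isT); clear; lia.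
- by rewrite leqnn (ltnW xy).
Qed.

Lemma ncmatching_NC n (w : 'S_n) : ncmatching w -> NC n w.
Proof.
move=> Mw; split; last exact: ncmatching_noncrossing.
exact/cyclically_decreasing_cycles/ncmatching_cyclically_decreasing.
Qed.

(** Chords at points of two orbits cannot cross because the orbits do not;
    chords at points of one orbit are successive sides of a polygon. *)
Lemma NC_ncmatching n (w : 'S_n) : NC n w -> ncmatching w.
Proof.
case=> /decreasing_cycles_cyclically Dw Nw; apply/ncmatchingP => x y xy.
have wxy : w x != w y by rewrite (inj_eq perm_inj).
move: xy wxy; rewrite -!val_eqE /= => xy wxy.
have Dx := Dw x; rewrite /chord_separates.
have [yx|yx] := boolP (y \in porbit w x).
  have := Dx y yx; have := Dx (w y); rewrite porbit_image yx => /(_ isT).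
  by move: xy wxy; clear; case: ifP; lia.
have BC : porbit w x != porbit w y by rewrite eq_sym eq_porbit_mem.
have disj z z' : z \in porbit w x -> z' \in porbit w y -> z != z' :> nat.
  move=> zx zy; apply: contra BC => /eqP/val_inj zz; rewrite -zz in zy.
  by move: zx zy; rewrite -!eq_porbit_mem => /eqP <- /eqP <-.
have Bx : porbit w x \in porbits w by exact: imset_f.
have By : porbit w y \in porbits w by exact: imset_f.
have ix := porbit_id w x; have iy := porbit_id w y.
have iwx : w x \in porbit w x by rewrite porbit_image.
have iwy : w y \in porbit w y by rewrite porbit_image.
have cross a b c d : a \in porbit w x -> b \in porbit w x ->
    c \in porbit w y -> d \in porbit w y ->
    ~~ [&& a < c, c < b & b < d] && ~~ [&& c < a, a < d & d < b].
  move=> aB bB cC dC; apply/andP; split; apply/negP => /and3P[H1 H2 H3].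
    by apply: (Nw _ _ Bx By BC); exists a, b, c, d.
  by rewrite eq_sym in BC; apply: (Nw _ _ By Bx BC); exists c, d, a, b.
have := disj _ _ ix iwy; have := disj _ _ iwx iy.
have := cross _ _ _ _ ix iwx iy iwy; have := cross _ _ _ _ ix iwx iwy iy.
have := cross _ _ _ _ iwx ix iy iwy; have := cross _ _ _ _ iwx ix iwy iy.
by move: xy wxy; clear; case: ifP; lia.
Qed.

(** w' is obtained from w by erasing p from its cycle and closing the gap among
    the values and positions. *)
Definition deletes m (p : 'I_m.+1) (w : 'S_m.+1) (w' : 'S_m) : Prop :=
  forall x, lift p (w' x) = if w (lift p x) == p then w p else w (lift p x).

(** The chord ending at 2p+1 starts at 2p or at 2p+2, the neighbours of 2p+1. *)
Definition short_chord m (p : 'I_m.+1) (w : 'S_m.+1) : Prop :=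
  exists2 q : 'I_m.+1, w q = p & p <= q <= p.+1.

(** A chord between neighbouring points crosses no other; what remains after
    its removal is the matching of w', up to an increasing relabelling of its
    endpoints. *)
Lemma ncmatching_delete m (p : 'I_m.+1) (w : 'S_m.+1) (w' : 'S_m) :
  deletes p w w' -> short_chord p w -> ncmatching w = ncmatching w'.
Proof.
move=> del [q wq pq].
apply/ncmatchingP/ncmatchingP => M x y; rewrite -val_eqE /= => xy.
  (* The chord of w' at z is the chord of w at X z. *)
  pose X (z : 'I_m) := if w (lift p z) == p then p else lift p z.
  have wX z : w (X z) = lift p (w' z) by rewrite del /X; case: ifP.
  have XE z : X z = lift p z :> nat \/ (X z = p :> nat /\ z = p :> nat).
    rewrite /X; case: eqP => [wz|_]; last by left.
    right; split=> //; have : lift p z = q by apply: (@perm_inj _ w); rewrite wz.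
    by move/(congr1 val); move: pq; rewrite /= /bump; clear; lia.
  have := M (X x) (X y); rewrite !wX -val_eqE /chord_separates /=.
  have := XE x; have := XE y; move: xy; rewrite /= /bump; clear.
  case: ifP => ?; case: ifP => ?; lia.
(* Conversely each chord of w, except the short one, comes from w'; when q is
   p+1 the point 2p takes over the role of the removed point 2q. *)
have key z : w z != p -> exists z' : 'I_m, w z = lift p (w' z') /\
    (z = lift p z' :> nat \/ [/\ z = p :> nat, z' = p :> nat & q = p.+1 :> nat]).
  move=> wz; case: (unliftP p z) => [z' zE|zp].
    by exists z'; rewrite del -zE (negPf wz); split; [|left].
  case: (unliftP p q) => [z' qE|qp]; last by rewrite -wq qp zp eqxx in wz.
  exists z'; rewrite del -qE wq eqxx zp; split=> //; right.
  by move/(congr1 val): qE pq; rewrite /= /bump; clear; split; lia.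
have short z : w z = p -> p <= z <= p.+1.
  by move=> wz; have -> : z = q by apply: (@perm_inj _ w); rewrite wz.
have [wx|wx] := eqVneq (w x) p.
  have wy : w y != p :> nat.
    by rewrite -wx val_eqE (inj_eq perm_inj) eq_sym -val_eqE.
  move: (short x wx) xy wy; rewrite wx /chord_separates; clear.
  by case: ifP; lia.
have [wy|wy] := eqVneq (w y) p.
  move: (short y wy) xy wx; rewrite -val_eqE wy /chord_separates /=; clear.
  by case: ifP; lia.
have [x' [wxE xE]] := key x wx; have [y' [wyE yE]] := key y wy.
have xy' : x' != y'.
  apply: contra xy => /eqP xy'; rewrite val_eqE -(inj_eq (@perm_inj _ w)).
  by rewrite wxE wyE xy'.
have nq z : w z != p -> z != q :> nat.
  by apply: contra => /eqP/val_inj ->; rewrite wq.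
have := M x' y' xy'; rewrite wxE wyE /chord_separates.
move: (nq x wx) (nq y wy) xy' xE yE; rewrite -val_eqE /= /bump; clear.
by case: ifP => ?; case: ifP => ? ? ? ? [?|[? ? ?]] [?|[? ? ?]]; lia.
Qed.

Local Open Scope ring_scope.

(** * Bases of the subspaces of a flag *)

(** When dim U = #|I|, this says that I is a basis of the matroid of U. *)
Definition separates (K : fieldType) n (U : {vspace 'cV[K]_n}) (I : {set 'I_n}) :=
  forall v, v \in U -> (forall j, j \in I -> v j 0 = 0) -> v = 0.

Definition firsts n (s : 'S_n) k : {set 'I_n} := [set j : 'I_n | (s^-1%g j < k)%N].

Definition chain (K : fieldType) n (F : flag K n) (s : 'S_n) : Prop :=
  forall k, (k <= n)%N -> separates (flag_nth F k) (firsts s k).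

Lemma in_firsts n (s : 'S_n) k a : (s a \in firsts s k) = (a < k)%N.
Proof. by rewrite inE permK. Qed.

Lemma card_firsts n (s : 'S_n) k : (k <= n)%N -> #|firsts s k| = k.
Proof.
move=> kn; have -> : firsts s k = s @: [set a : 'I_n | (a < k)%N].
  apply/setP => j; apply/idP/imsetP => [jk|[a ak ->]].
    by exists (s^-1%g j); rewrite ?permKV // inE; move: jk; rewrite inE.
  by rewrite in_firsts; move: ak; rewrite inE.
rewrite card_imset; last exact: perm_inj.
by rewrite cardsE -sum1_card (big_ord_narrow kn) sum1_card card_ord.
Qed.

Lemma flag_nth0 (K : fieldType) n (F : flag K n) : flag_nth F 0 = 0%VS.
Proof. by apply/eqP; rewrite -dimv_eq0 dim_flag_nth. Qed.

Lemma vanishing_vector (K : fieldType) n (U : {vspace 'cV[K]_n}) (I : {set 'I_n}) :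
  (#|I| < \dim U)%N ->
  exists v, [/\ v \in U, v != 0 & forall j, j \in I -> v j 0 = 0].
Proof.
move=> IU; pose fl := @mxsub K n 1 #|I| 1 (@enum_val _ (mem I)) id.
pose W := (U :&: lker (linfun fl))%VS.
have W0 : W != 0%VS.
  rewrite -dimv_eq0; have := limg_ker_dim (linfun fl) U.
  have : (\dim (linfun fl @: U) <= #|I|)%N.
    by apply: leq_trans (dimvS (subvf _)) _; rewrite dimvf /dim /= muln1.
  move=> dI dW; apply: contraTneq IU => W0.
  by rewrite -leqNgt -dW -/W W0 add0n.
have := memv_pick W; rewrite memv_cap memv_ker lfunE /= => /andP[vU /eqP v0].
exists (vpick W); split=> //; first by rewrite vpick0.
move=> j jI; have /colP/(_ (enum_rank_in jI j)) := v0.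
by rewrite !mxE enum_rankK_in.
Qed.

(** Augmentation of a basis: the vectors of U' vanishing on I form the line
    spanned by w, so any coordinate at which w is nonzero completes I. *)
Lemma separates_extend (K : fieldType) n (U U' : {vspace 'cV[K]_n})
    (I : {set 'I_n}) w j :
  (U <= U')%VS -> (\dim U' <= (\dim U).+1)%N -> separates U I ->
  w \in U' -> (forall i, i \in I -> w i 0 = 0) -> w j 0 != 0 ->
  (U' = U + <[w]>)%VS /\ separates U' (j |: I).
Proof.
move=> UU dU sU wU wI wj.
have w0 : w != 0 by apply: contraNneq wj => ->; rewrite mxE.
have wnU : w \notin U by apply: contra w0 => wU0; apply/eqP/(sU w).
have E : (U' = U + <[w]>)%VS.
  apply/esym/eqP; rewrite eqEdim subv_add UU -memvE wU /=.
  apply: leq_trans dU _; rewrite dimv_disjoint_sum ?dim_vline ?w0 ?addn1 //.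
  apply/eqP; rewrite -subv0; apply/subvP => v.
  rewrite memv_cap => /andP[vU /vlineP[c vE]].
  move: vU; rewrite vE rpredZeq; case/orP => [/eqP->|wU1].
    by rewrite scale0r mem0v.
  by rewrite wU1 in wnU.
split=> // v; rewrite E => /memv_addP[x xU [y /vlineP[c ->] ->]] vI.
have x0 : x = 0.
  apply: (sU x) => // i iI; have := vI i; rewrite !inE iI orbT => /(_ isT).
  by rewrite !mxE wI // mulr0 addr0.
have := vI j; rewrite x0 add0r setU11 mxE => /(_ isT) /eqP.
by rewrite mulf_eq0 (negPf wj) orbF => /eqP->; rewrite scale0r.
Qed.

(** The k-th step of the greedy algorithm for an order on the coordinates in
    which q is preferred to all others and p comes last: p is used only if it
    is in every basis of F_k, and q as soon as it is in some basis of F_k. *)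
Definition greedy (K : fieldType) n (F : flag K n) (p q : 'I_n) k
    (I : {set 'I_n}) : Prop :=
  [/\ separates (flag_nth F k) I,
      p \in I -> delta_mx p 0 \in flag_nth F k
    & forall v, v \in flag_nth F k -> v q 0 != 0 -> q \in I].

Lemma greedy_extend (K : fieldType) n (F : flag K n) (p q : 'I_n) k
    (I : {set 'I_n}) :
  p != q -> (k < n)%N -> #|I| = k -> greedy F p q k I ->
  exists2 j, j \notin I & greedy F p q k.+1 (j |: I).
Proof.
move=> pq kn cI [sI pI qI].
have FS : (flag_nth F k <= flag_nth F k.+1)%VS by rewrite flag_nthS // leqnSn.
have [|w [wF w0 wI]] := @vanishing_vector K n (flag_nth F k.+1) I.
  by rewrite cI dim_flag_nth.
(* Choose q if possible, and p only if w is a multiple of e_p. *)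
have [j wj [jq jp]] : exists2 j, w j 0 != 0
    & (w q 0 != 0 -> j = q) /\ (j = p -> w = w p 0 *: delta_mx p 0).
  have [wq|wq] := eqVneq (w q 0) 0; last first.
    by exists q => //; split=> // qp; rewrite qp eqxx in pq.
  have [/existsP[j /andP[jp wj]]|] := boolP [exists j, (j != p) && (w j 0 != 0)].
    by exists j => //; split=> [//|jp']; rewrite jp' eqxx in jp.
  rewrite negb_exists => /forallP wp.
  have wE : w = w p 0 *: delta_mx p 0.
    apply/colP => j; rewrite !mxE eqxx andbT.
    have := wp j; rewrite negb_and !negbK.
    by case: eqP => [->|_ /= /eqP->]; rewrite ?mulr1 ?mulr0.
  exists p; last by split.
  by apply: contraNneq w0 => wp0; rewrite wE wp0 scale0r.
have [|FE sF] := separates_extend FS _ sI wF wI wj.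
  by rewrite !dim_flag_nth // ltnW.
exists j; first by apply: contra wj => /wI ->.
split=> //.
  rewrite in_setU1 => /orP[/eqP pj|/pI]; last exact: (subvP FS).
  rewrite -pj in wj; move: wF.
  by rewrite {1}(jp (esym pj)) rpredZeq (negPf wj).
move=> v; rewrite FE => /memv_addP[x xF [y /vlineP[c ->] ->]].
rewrite in_setU1 !mxE; have [->|x0 cw] := eqVneq (x q 0) 0.
  by rewrite add0r mulf_eq0 negb_or => /andP[_ /jq->]; rewrite eqxx.
by rewrite (qI x xF x0) orbT.
Qed.

Lemma greedy_chain (K : fieldType) n (F : flag K n) (p q : 'I_n) : p != q ->
  exists s : 'S_n, forall k, (k <= n)%N -> greedy F p q k (firsts s k).
Proof.
move=> pq.
have seqs m : (m <= n)%N -> exists s : seq 'I_n, [/\ size s = m, uniq s &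
    forall k, (k <= m)%N -> greedy F p q k [set j in take k s]].
  elim: m => [_|m IHm mn].
    exists [::]; split=> // k; rewrite leqn0 => /eqP->; rewrite /greedy flag_nth0.
    by split=> [v||v]; rewrite ?inE // memv0 => /eqP-> //; rewrite mxE eqxx.
  have [s [ss us gs]] := IHm (ltnW mn).
  have gm := gs m (leqnn m); rewrite -{2}ss take_size in gm.
  have [|j js gj] := greedy_extend pq mn _ gm.
    by rewrite cardsE (card_uniqP us).
  exists (rcons s j); split; rewrite ?size_rcons ?ss //.
    by rewrite rcons_uniq us andbT; rewrite inE in js.
  move=> k; rewrite leq_eqVlt ltnS => /orP[/eqP->|km].
    rewrite -cats1 take_oversize ?size_cat ?ss ?addn1 //.
    suff -> : [set i in s ++ [:: j]] = j |: [set i in s] by [].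
    by apply/setP => i; rewrite !inE mem_cat inE orbC.
  by rewrite -cats1 takel_cat ?ss //; exact: gs.
have [s [ss us gs]] := seqs n (leqnn n).
have sinj : injective (fun a : 'I_n => nth p s a).
  move=> a b /eqP; rewrite nth_uniq ?ss // => /eqP; exact: val_inj.
exists (perm sinj) => k kn.
suff -> : firsts (perm sinj) k = [set j in take k s] by exact: gs.
apply/setP => j; rewrite -(permKV (perm sinj) j) in_firsts inE permE.
set a := (_ j); have aS : (a < size s)%N by rewrite ss.
by rewrite in_take ?mem_nth // index_uniq.
Qed.

(** * Nonvanishing Pluecker functions *)

(** The k-th minor is nonzero when the square system expressing that h c, for c
    supported on the first k coordinates, vanishes at s(0), ..., s(k-1) has only
    the zero solution. *)
Lemma Pl_neq0_chain (K : fieldType) n (h : 'M[K]_n) (F : flag K n) (s : 'S_n) :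
  represents h F -> Pl s h != 0 <-> chain F s.
Proof.
move=> [hu hF]; have memF k v : (k <= n)%N -> reflect (exists c : 'cV[K]_n,
    (forall l : 'I_n, (k <= l)%N -> c l 0 = 0) /\ v = h *m c) (v \in flag_nth F k).
  by move=> kn; rewrite hF //; exact: mem_span_colP.
pose A (k : 'I_n) : 'M[K]_k.+1 := \matrix_(a, b)
  h (s (widen_ord (ltn_ord k) a)) (widen_ord (ltn_ord k) b).
have Ac (k : 'I_n) (c : 'cV[K]_n) (a : 'I_k.+1) :
    (forall l : 'I_n, (k < l)%N -> c l 0 = 0) ->
    (A k *m \col_b c (widen_ord (ltn_ord k) b) 0) a 0
      = (h *m c) (s (widen_ord (ltn_ord k) a)) 0.
  move=> c0; rewrite !mxE (bigID (fun l : 'I_n => (l < k.+1)%N)) /=.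
  rewrite [X in _ + X]big1 ?addr0 => [|l]; last first.
    by rewrite -leqNgt => kl; rewrite c0 // mulr0.
  by rewrite (big_ord_narrow (ltn_ord k)); apply: eq_bigr => l _; rewrite !mxE.
split=> [/prodf_neq0 P0 k kn v|cs].
  case: k kn => [_|k kn]; first by rewrite flag_nth0 memv0 => /eqP.
  have Au : A (Ordinal kn) \in unitmx by rewrite unitmxE unitfE (P0 (Ordinal kn)).
  move/(memF _ _ kn) => [c [c0 ->]] v0.
  suff -> : c = 0 by rewrite mulmx0.
  set c' := \col_b c (widen_ord (ltn_ord (Ordinal kn)) b) 0.
  have c'0 : c' = 0.
    apply: (can_inj (mulKmx Au)); rewrite mulmx0; apply/colP => a.
    by rewrite Ac // v0 ?mxE // in_firsts /= ltn_ord.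
  apply/colP => l; rewrite mxE; case: (ltnP l k.+1) => lk; last exact: c0.
  have /colP/(_ (Ordinal lk)) := c'0; rewrite !mxE => <-.
  by congr (c _ _); apply: val_inj.
apply/prodf_neq0 => k _; rewrite -/(A k) -det_tr; apply/negP => /det0P[u u0 uA].
pose c : 'cV[K]_n := \col_l (if insub (l : nat) is Some b then u 0 b else 0).
have c0 (l : 'I_n) : (k < l)%N -> c l 0 = 0.
  by move=> kl; rewrite mxE insubN // -leqNgt.
have cu : \col_b c (widen_ord (ltn_ord k) b) 0 = u^T.
  apply/colP => b; rewrite !mxE.
  case: insubP => [b' _ bb'|]; last by rewrite /= ltn_ord.
  by congr (u 0 _); apply: val_inj.
have Au : A k *m u^T = 0 by rewrite -[A k]trmxK -trmx_mul uA trmx0.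
have hc : h *m c = 0.
  apply: (cs k.+1 (ltn_ord k)) => [|j].
    by apply/(memF _ _ (ltn_ord k)); exists c.
  rewrite inE => jk; have := Ac k c (Ordinal jk) c0.
  rewrite cu Au mxE => ->; congr ((h *m c) _ _).
  by rewrite -[LHS](permKV s); congr (s _); apply: val_inj.
move: u0; rewrite -[u]trmxK -cu; case/eqP; apply/rowP => b.
have -> : c = 0 by apply: (can_inj (mulKmx hu)); rewrite hc mulmx0.
by rewrite !mxE.
Qed.

(** * A coordinate that can be removed *)

(** Take the least p with e_p in F_(p+2).  If k < p then e_k is not in F_(k+2);
    if moreover F_(k+1) had a vector with nonzero (k+1)-st coordinate, a greedy
    chain would have crossing chords.  So F_k lies in x_k = 0 for all k <= p. *)
Lemma exists_deletable (K : fieldType) m (F : flag K m.+1) :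
  (0 < m)%N -> (forall s, chain F s -> ncmatching s) ->
  exists p : 'I_m.+1, [/\ (p < m)%N, forall v, v \in flag_nth F p -> v p 0 = 0
    & delta_mx p 0 \in flag_nth F p.+2].
Proof.
move=> m0 Fnc.
pose P r := (r < m)%N && (delta_mx (inord r : 'I_m.+1) 0 \in flag_nth F r.+2).
have exP : exists r, P r.
  exists m.-1; rewrite /P prednK // leqnn /=.
  suff -> : flag_nth F m.+1 = fullv by exact: memvf.
  by apply/eqP; rewrite eqEdim subvf dimvf dim_flag_nth ?leqnn // /dim /= muln1.
case: (ex_minnP exP) => r /andP[rm er] rmin.
suff Fr k : (k <= r)%N -> forall v, v \in flag_nth F k -> v (inord k) 0 = 0.
  exists (inord r); rewrite inordK; last by rewrite ltnW.
  by split=> //; exact: Fr.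
elim: k => [_ v|k _ kr v vF].
  by rewrite flag_nth0 memv0 => /eqP->; rewrite mxE.
apply/eqP; apply: contraLR kr => vk; rewrite -leqNgt.
have [km|] := ltnP k m; last by move: rm; clear; lia.
apply: rmin; rewrite /P km /=; apply: contraT => ek.
have pk : (inord k : 'I_m.+1) = k :> nat by rewrite inordK // ltnW.
have qk : (inord k.+1 : 'I_m.+1) = k.+1 :> nat by rewrite inordK.
set p := inord k in pk ek *; set q := inord k.+1 in qk vk *.
have pq : p != q by rewrite -val_eqE /= pk qk; clear; lia.
have [s gs] := greedy_chain F pq.
have cs : chain F s by move=> l /gs[].
have [_ _ /(_ v vF vk)] := gs k.+1 (ltnW km); rewrite inE => qs.
have [_ + _] := gs k.+2 km; rewrite inE => /contra/(_ ek) ps.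
have xy : (s^-1%g p) != (s^-1%g q) by rewrite (inj_eq perm_inj).
have := (ncmatchingP _ (Fnc s cs)) _ _ xy.
rewrite !permKV /chord_separates pk qk; move: qs ps; clear.
by case: ifP; lia.
Qed.

(** * Inserting a coordinate into a flag *)

(** The relation between F and G in the definition of P_(p+1), where the
    coordinate p is counted from 0. *)
Definition extends_at (K : fieldType) m (p : 'I_m.+1) (F : flag K m)
    (G : flag K m.+1) : Prop :=
  (forall j, (j <= p)%N -> flag_nth G j = (linfun (ins0 p) @: flag_nth F j)%VS) /\
  (forall j, (p.+1 < j <= m.+1)%N ->
     flag_nth G j = (linfun (ins0 p) @: flag_nth F j.-1 + <[delta_mx p ord0]>)%VS).

Lemma PopP (K : fieldType) m (p : 'I_m.+1) (Z : set (flag K m)) G :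
  Pop p.+1 Z G <-> exists2 F, Z F & extends_at p F G.
Proof. by rewrite /Pop /= inord_val. Qed.

Lemma ins0_lift (K : fieldType) m (p : 'I_m.+1) (v : 'cV[K]_m) j :
  ins0 p v (lift p j) 0 = v j 0.
Proof. by rewrite mxE liftK. Qed.

Lemma ins0_at (K : fieldType) m (p : 'I_m.+1) (v : 'cV[K]_m) : ins0 p v p 0 = 0.
Proof. by rewrite mxE unlift_none. Qed.

Lemma ins0_inj (K : fieldType) m (p : 'I_m.+1) : injective (@ins0 K m p).
Proof. by move=> u v /colP uv; apply/colP => j; rewrite -!(ins0_lift p) uv. Qed.

Lemma ins0_surj (K : fieldType) m (p : 'I_m.+1) (v : 'cV[K]_m.+1) :
  v p 0 = 0 -> v = ins0 p (\col_j v (lift p j) 0).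
Proof.
move=> vp; apply/colP => j; case: (unliftP p j) => [j' ->|->].
  by rewrite ins0_lift mxE.
by rewrite ins0_at.
Qed.

Lemma dim_ins0 (K : fieldType) m (p : 'I_m.+1) (U : {vspace 'cV[K]_m}) :
  \dim (linfun (ins0 p) @: U) = \dim U.
Proof.
apply: limg_dim_eq; apply/eqP; rewrite -subv0; apply/subvP => v.
rewrite memv_cap memv_ker lfunE memv0 => /andP[_ /eqP v0].
by apply/eqP/(@ins0_inj K m p); rewrite v0 linear0.
Qed.

Lemma mem_ins0_img (K : fieldType) m (p : 'I_m.+1) (U : {vspace 'cV[K]_m}) v :
  (ins0 p v \in linfun (ins0 p) @: U)%VS = (v \in U).
Proof.
apply/memv_imgP/idP => [[u uU]|vU]; last by exists v; rewrite ?lfunE.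
by rewrite lfunE => /ins0_inj ->.
Qed.

Lemma dim_ins0_addv (K : fieldType) m (p : 'I_m.+1) (U : {vspace 'cV[K]_m}) :
  \dim (linfun (ins0 p) @: U + <[delta_mx p ord0]>) = (\dim U).+1.
Proof.
rewrite dimv_disjoint_sum ?dim_ins0 ?dim_vline.
  have -> : delta_mx p ord0 != 0 :> 'cV[K]_m.+1; last by rewrite addn1.
  by apply/eqP => /colP/(_ p)/eqP; rewrite !mxE !eqxx oner_eq0.
apply/eqP; rewrite -subv0; apply/subvP => v; rewrite memv_cap memv0.
case/andP=> /memv_imgP[u _ ->] /vlineP[c]; rewrite lfunE => uc.
have c0 : c = 0.
  by have /colP/(_ p) := uc; rewrite ins0_at !mxE !eqxx mulr1.
by rewrite uc c0 scale0r.
Qed.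

(** [bump p.+1] skips the index p+1, the one at which G is unconstrained. *)
Lemma mem_extends (K : fieldType) m (p : 'I_m.+1) (F : flag K m) G k v :
  extends_at p F G -> (k <= m)%N ->
  (ins0 p v \in flag_nth G (bump p.+1 k)) = (v \in flag_nth F k).
Proof.
move=> [G1 G2] km; rewrite /bump; case: (ltnP p k) => pk /=.
  rewrite add1n G2 ?ltnS ?pk //= -(mem_ins0_img p).
  apply/memv_addP/idP => [|vF]; last first.
    by exists (ins0 p v) => //; exists 0; rewrite ?mem0v ?addr0.
  case=> x /memv_imgP[u uF ->] [y /vlineP[c ->]]; rewrite lfunE => uc.
  have /colP/(_ p)/esym := uc; rewrite mxE !ins0_at !mxE !eqxx mulr1 add0r => c0.
  by rewrite uc c0 scale0r addr0 -lfunE memv_img.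
by rewrite G1 // mem_ins0_img.
Qed.

(** Both conditions on p pass to the other subspaces by inclusion, so that
    F_k = G_k for k <= p and F_k = G_(k+1) / e_p for k > p, seen in the
    hyperplane x_p = 0, have the right dimensions. *)
Lemma delete_flag (K : fieldType) m (p : 'I_m.+1) (G : flag K m.+1) :
  (p < m)%N -> (forall v, v \in flag_nth G p -> v p 0 = 0) ->
  delta_mx p 0 \in flag_nth G p.+2 -> exists F, extends_at p F G.
Proof.
move=> pm Gp Gp2.
pose S j := (linfun (ins0 p) @^-1: flag_nth G (bump p.+1 j))%VS.
have memS j v : (v \in S j) = (ins0 p v \in flag_nth G (bump p.+1 j)).
  by rewrite -memv_preim lfunE.
have lowS j : (j <= p)%N -> flag_nth G j = (linfun (ins0 p) @: S j)%VS.
  move=> jp; apply/eqP; rewrite eqEsubv; apply/andP; split; apply/subvP => v.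
    move=> vG; have /ins0_surj vE : v p 0 = 0.
      by apply: Gp; apply: (subvP (flag_nthS _ _)) vG; rewrite jp ltnW.
    by rewrite vE mem_ins0_img memS /bump ltnNge jp -vE.
  by move/memv_imgP => [u + ->]; rewrite lfunE memS /bump ltnNge jp.
have highS j : (p.+1 < j <= m.+1)%N ->
    flag_nth G j = (linfun (ins0 p) @: S j.-1 + <[delta_mx p ord0]>)%VS.
  case: j => // j; rewrite !ltnS /= => /andP[pj jm].
  have eG : delta_mx p 0 \in flag_nth G j.+1.
    by apply: (subvP (flag_nthS _ _)) Gp2; rewrite !ltnS pj.
  apply/eqP; rewrite eqEsubv; apply/andP; split.
    apply/subvP => v vG; pose u := v - v p 0 *: delta_mx p 0.
    have uG : u \in flag_nth G j.+1 by rewrite memvB // memvZ.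
    have /ins0_surj uE : u p 0 = 0 by rewrite !mxE !eqxx mulr1 subrr.
    apply/memv_addP; exists u; last first.
      by exists (v p 0 *: delta_mx p 0); rewrite ?memvZ ?memv_line // subrK.
    by rewrite uE mem_ins0_img memS /bump pj -uE.
  rewrite subv_add -memvE eG andbT; apply/subvP => v /memv_imgP[u + ->].
  by rewrite lfunE memS /bump pj.
have dimS j : (j <= m)%N -> \dim (S j) = j.
  move=> jm; case: (leqP j p) => jp.
    by rewrite -(dim_ins0 p) -lowS // dim_flag_nth // ltnW.
  apply: succn_inj; rewrite -(dim_ins0_addv p) -(highS j.+1) ?dim_flag_nth //.
  by rewrite !ltnS jp.
have Fl : is_flag [ffun j : 'I_m.+1 => S j].
  apply/andP; split; first by apply/forallP => j; rewrite ffunE dimS // -ltnS.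
  apply/forallP => j; apply/forallP => k; rewrite !ffunE; apply/implyP => jk.
  apply/subvP => v; rewrite !memS; apply: (subvP (flag_nthS _ _)).
  by have := ltn_ord k; move: jk; rewrite /bump; clear; lia.
exists (Flag Fl); split=> j.
  move=> jp; rewrite {2}/flag_nth /= ffunE inordK ?lowS //.
  by rewrite ltnS (leq_trans jp) // ltnW.
case: j => // j jm; rewrite {2}/flag_nth /= ffunE inordK ?highS //.
by case/andP: jm.
Qed.

(** Composing s with the transposition of p and s^-1 p gives a permutation which
    fixes p and coincides otherwise with the result of erasing p. *)
Lemma deletes_exists m (p : 'I_m.+1) (s : 'S_m.+1) :
  exists s' : 'S_m, deletes p s s'.
Proof.
pose t := (tperm p (s^-1 p) * s)%g.
have tp : t p = p by rewrite permM tpermL permKV.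
pose f (x : 'I_m) : 'I_m := odflt x (unlift p (t (lift p x))).
have fE x : lift p (f x) = t (lift p x).
  rewrite /f; case: unliftP => [y ->//|tx].
  have /eqP : p = lift p x by apply: (@perm_inj _ t); rewrite tx.
  by rewrite (negPf (neq_lift _ _)).
have finj : injective f.
  by move=> x y /(congr1 (lift p)); rewrite !fE => /perm_inj/lift_inj.
exists (perm finj) => x; rewrite permE fE permM.
have [sx|sx] := eqVneq; first by rewrite (canRL (permK s) sx) tpermR.
by rewrite tpermD ?neq_lift //; apply: contra sx => /eqP<-; rewrite permKV.
Qed.

(** No basis of G_k contains p for k <= p, and every basis of G_(p+2) does. *)
Lemma extends_short_chord (K : fieldType) m (p : 'I_m.+1) (F : flag K m) G s :
  (p < m)%N -> extends_at p F G -> chain G s -> short_chord p s.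
Proof.
move=> pm [G1 G2] cs; exists (s^-1%g p); first by rewrite permKV.
apply/andP; split; rewrite leqNgt; apply/negP => qp.
  set q := (s^-1%g p) in qp; have qm : (q < m.+1)%N := ltn_ord q.
  have [|v [vG v0 vI]] := @vanishing_vector K _ (flag_nth G q.+1) (firsts s q).
    by rewrite dim_flag_nth // card_firsts // ltnW.
  case/eqP: v0; apply: (cs q.+1 qm v vG) => j; rewrite inE ltnS leq_eqVlt.
  case/orP=> [/eqP/val_inj/perm_inj->|jq]; last by apply: vI; rewrite inE.
  by move: vG; rewrite G1 // => /memv_imgP[u _ ->]; rewrite lfunE /= ins0_at.
have eG : delta_mx p 0 \in flag_nth G p.+2.
  by rewrite G2 ?ltnS ?leqnn //; apply/(subvP (addvSr _ _))/memv_line.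
suff /colP/(_ p)/eqP : delta_mx p 0 = 0 :> 'cV[K]_m.+1.
  by rewrite !mxE !eqxx oner_eq0.
apply: (cs p.+2 _ _ eG) => // j; rewrite inE mxE => jp.
by case: eqP jp => // -> jp; move: qp; rewrite ltnNge -ltnS jp.
Qed.

(** Erasing p from the basis of G_(bump p.+1 k) given by s leaves a basis of
    F_k. *)
Lemma chain_delete (K : fieldType) m (p : 'I_m.+1) (F : flag K m) G s s' :
  (p < m)%N -> extends_at p F G -> deletes p s s' -> chain G s -> chain F s'.
Proof.
move=> pm GF del cs k km v; rewrite -(mem_extends _ GF km) => vG v0.
have [q sq pq] := extends_short_chord pm GF cs.
have bm : (bump p.+1 k <= m.+1)%N by rewrite /bump; move: km; clear; lia.
apply: (@ins0_inj K m p); rewrite linear0; apply: (cs _ bm _ vG) => j.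
case: (unliftP p j) => [j' ->|-> _]; last exact: ins0_at.
rewrite ins0_lift inE => jk; apply: v0; rewrite inE.
set x := (s'^-1%g j'); have := del x; rewrite permKV.
case: eqP => [sx|_] jE; move: jk; rewrite jE permK.
  have : lift p x = q by apply: (@perm_inj _ s); rewrite sq.
  by move/(congr1 val); move: pq; rewrite /= /bump; clear; lia.
by rewrite /= /bump; clear; lia.
Qed.

Lemma firstsS n (s : 'S_n) (a : 'I_n) : firsts s a.+1 = s a |: firsts s a.
Proof.
apply/setP => j; rewrite !inE ltnS leq_eqVlt; congr (_ || _).
by rewrite val_eqE (canF_eq (permKV s)).
Qed.

Lemma deletes_lift_perm m (p : 'I_m.+1) (s' : 'S_m) :
  deletes p (lift_perm p p s') s'.
Proof.
by move=> x; rewrite lift_perm_lift eq_sym (negPf (neq_lift _ _)).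
Qed.

Lemma deletes_tperm m (p q : 'I_m.+1) (s' : 'S_m) : p != q ->
  deletes p (tperm p q * lift_perm p p s')%g s'.
Proof.
move=> pq x; rewrite !permM tpermL.
have [->|qx] := eqVneq q (lift p x).
  by rewrite tpermR lift_perm_id eqxx lift_perm_lift.
by rewrite tpermD ?neq_lift // lift_perm_lift eq_sym (negPf (neq_lift _ _)).
Qed.

(** Away from the level p+1, the bases along a chain of G are those along a
    chain of F, with p added from level p+2 on.  The position p or p+1 of p in
    the chain matters at level p+1 only. *)
Lemma separates_lift (K : fieldType) m (p : 'I_m.+1) (F : flag K m) G s s' k :
  (p < m)%N -> extends_at p F G -> deletes p s s' -> short_chord p s ->
  chain F s' -> (k <= m.+1)%N -> k != p.+1 -> separates (flag_nth G k) (firsts s k).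
Proof.
move=> pm GF del [q sq pq] cs km kp v vG v0.
have qp x : s (lift p x) == p -> x = p :> nat /\ q = p.+1 :> nat.
  move=> /eqP sx; have : lift p x = q by apply: (@perm_inj _ s); rewrite sq.
  by move/(congr1 val); move: pq; rewrite /= /bump; clear; split; lia.
have vp : v p 0 = 0.
  have [pk|kp'] := ltnP p.+1 k.
    by apply: v0; rewrite -sq in_firsts; move: pk pq; clear; lia.
  have {}kp' : (k <= p)%N by move: kp kp'; clear; lia.
  by move: vG; rewrite GF.1 // => /memv_imgP[u _ ->]; rewrite lfunE /= ins0_at.
have vE := ins0_surj vp; set u := \col_j _ in vE.
have ku : exists2 k', k = bump p.+1 k' & (k' <= m)%N.
  case: (ltnP p.+1 k) => pk; last first.
    by exists k; move: pm km kp pk; rewrite /bump; clear; lia.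
  by exists k.-1; move: pm km kp pk; rewrite /bump; clear; lia.
case: ku => k' kk' k'm.
move: vG; rewrite {1}vE kk' (mem_extends _ GF) // => uF.
rewrite vE; suff -> : u = 0 by rewrite linear0.
apply: (cs k' k'm _ uF) => j; rewrite mxE inE => jk; apply: v0.
rewrite inE -[j](permKV s') del; set x := (s'^-1%g j) in jk *.
case: ifP => [/qp[xp _]|_]; rewrite permK kk'.
  by move: jk; rewrite xp /bump; clear; lia.
by move: jk; rewrite /= /bump; clear; lia.
Qed.

(** The value p can be inserted at position p or at position p+1, and these
    two orderings differ at level p+1 only.  There G_(p+1) is G_p plus a line,
    spanned by a vector w vanishing on the first p coordinates of the chain.
    If w_p is nonzero the first choice works; otherwise the other new coordinate
    of level p+2 must be nonzero at w, and the second choice works. *)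
Lemma chain_lift (K : fieldType) m (p : 'I_m.+1) (F : flag K m) G s' :
  (p < m)%N -> extends_at p F G -> chain F s' ->
  exists s, [/\ chain G s, deletes p s s' & short_chord p s].
Proof.
move=> pm GF cs'; pose q : 'I_m.+1 := inord p.+1.
have qE : q = p.+1 :> nat by rewrite inordK.
have pq : p != q by rewrite -val_eqE /= qE; clear; lia.
pose sA := lift_perm p p s'; pose sB := (tperm p q * sA)%g.
have delA : deletes p sA s' by exact: deletes_lift_perm.
have delB : deletes p sB s' by exact: deletes_tperm.
have shA : short_chord p sA by exists p; rewrite ?lift_perm_id //; clear; lia.
have shB : short_chord p sB.
  by exists q; rewrite ?permM ?tpermR ?lift_perm_id // qE; clear; lia.
have pick s : deletes p s s' -> short_chord p s ->
    separates (flag_nth G p.+1) (firsts s p.+1) -> chain G s.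
  move=> del sh sp k km; have [->//|kp] := eqVneq k p.+1.
  exact: separates_lift GF del sh cs' km kp.
have pm1 : (p <= m.+1)%N by apply/ltnW/ltn_ord.
have [|w [wG w0 wI]] := @vanishing_vector K _ (flag_nth G p.+1) (firsts sA p).
  by rewrite dim_flag_nth // card_firsts.
have ext j : w j 0 != 0 -> separates (flag_nth G p.+1) (j |: firsts sA p).
  move=> wj; have pS : (p <= p.+1)%N by [].
  have FS : (flag_nth G p <= flag_nth G p.+1)%VS by rewrite flag_nthS // pS /=.
  have dS : (\dim (flag_nth G p.+1) <= (\dim (flag_nth G p)).+1)%N.
    by rewrite !dim_flag_nth.
  have sG : separates (flag_nth G p) (firsts sA p).
    by apply: (separates_lift pm GF delA shA cs' pm1); clear; lia.
  by have [] := separates_extend FS dS sG wG wI wj.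
have [wp|wp] := eqVneq (w p 0) 0; last first.
  exists sA; split=> //; apply: pick => //.
  by rewrite firstsS lift_perm_id; exact: ext.
exists sB; split=> //; apply: pick => //.
have -> : firsts sB p.+1 = sA q |: firsts sA p.
  rewrite firstsS permM tpermL; congr (_ |: _); apply/setP => j.
  rewrite -[j](permKV sB) in_firsts permM in_firsts.
  by case: tpermP => [->|->|//]; rewrite ?qE; clear; lia.
apply: ext; apply: contraNneq w0 => wq.
have sepA : separates (flag_nth G p.+2) (firsts sA p.+2).
  by apply: (separates_lift pm GF delA shA cs'); move: pm; clear; lia.
apply/eqP; apply: sepA => [|j].
  by apply: (subvP (flag_nthS _ _)) wG; rewrite leqnSn.
rewrite -qE firstsS qE firstsS lift_perm_id !in_setU1.
by case/or3P=> [/eqP->|/eqP->|/wI].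
Qed.

(** * The quasisymmetric flag variety *)

Lemma eq_iter_Pop (K : fieldType) i i' n :
  (forall j, (j < n)%N -> i j = i' j) -> iter_Pop K i n = iter_Pop K i' n.
Proof.
elim: n => //= n IHn ii'; case: eqP => // _.
by rewrite ii' // IHn // => j jn; apply: ii'; rewrite ltnS ltnW.
Qed.

Lemma iter_Pop_chain (K : fieldType) i n (F : flag K n) s :
  admissible n i -> iter_Pop K i n F -> chain F s -> ncmatching s.
Proof.
elim: n F s => [//|m IHm] G s ai /=.
case: eqP => [m0 _ _|/eqP m0].
  apply/ncmatchingP => x y; subst m; by rewrite !ord1.
have /andP[i1 im] : (1 <= i m <= m)%N by apply: ai; rewrite lt0n m0 leqnn.
have pE : (inord (i m).-1 : 'I_m.+1).+1 = i m.
  by rewrite inordK; move: i1 im; clear; lia.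
set p : 'I_m.+1 := inord _ in pE.
rewrite -pE => /PopP[F ZF GF] cs.
have pm : (p < m)%N by rewrite pE; exact: im.
have [s' del] := deletes_exists p s.
rewrite (ncmatching_delete del (extends_short_chord pm GF cs)).
apply: IHm ZF (chain_delete pm GF del cs) => j /andP[j0 jm].
by apply: ai; rewrite j0 ltnW.
Qed.

Lemma chain_iter_Pop (K : fieldType) m (F : flag K m.+1) :
  (forall s, chain F s -> ncmatching s) ->
  exists2 i, admissible m.+1 i & iter_Pop K i m.+1 F.
Proof.
elim: m F => [|m IHm] G Gnc.
  by exists (fun _ => 1%N) => // j; clear; lia.
have [p [pm Gp eG]] := exists_deletable (ltn0Sn m) Gnc.
have [F GF] := delete_flag pm Gp eG.
have [s' cs'|i ai Fi] := IHm F.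
  have [s [cs del sh]] := chain_lift pm GF cs'.
  by rewrite -(ncmatching_delete del sh) Gnc.
(* The last operation of the sequence recovers G from F. *)
exists (fun j => if j == m.+1 then p.+1 else i j) => [j /andP[j0 jm]|].
  case: eqP => [->|/eqP jm']; first by rewrite ltnS pm.
  by apply: ai; rewrite j0 ltn_neqAle jm'.
rewrite [iter_Pop _ _ _]/= eqxx; apply/PopP; exists F => //.
have := Fi; rewrite -[X in X -> _]/(iter_Pop K i m.+1 F).
rewrite (@eq_iter_Pop K _ (fun j => if j == m.+1 then p.+1 else i j)) // => j jm.
by case: eqP jm => // ->; rewrite ltnn.
Qed.

Lemma Pl_zero_chain (K : fieldType) n (F : flag K n) s :
  Pl_zero s F \/ chain F s.
Proof.
have [h hF] := represents_exists_mx F.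
have [P0|P0] := eqVneq (Pl s h) 0; first by left; apply/(Pl_zeroE _ hF).
by right; apply/(Pl_neq0_chain _ hF).
Qed.

Lemma chain_Pl_zero (K : fieldType) n (F : flag K n) s :
  chain F s -> ~ Pl_zero s F.
Proof. by move=> cs [h hF /eqP]; apply/negP/(Pl_neq0_chain _ hF). Qed.

Local Open Scope classical_set_scope.

Theorem theorem2 (R : realType) (n : nat) (n_ge1 : (1 <= n)%N) :
  QFl R[i] n = \bigcap_(s in ~` NC n) @Pl_zero R[i] n s.
Proof.
rewrite QFlE //; apply/seteqP; split=> F.
  move=> [i ai Fi] s nNC; have [//|cs] := Pl_zero_chain F s.
  by case: nNC; apply/ncmatching_NC/(iter_Pop_chain ai Fi cs).
case: n n_ge1 F => // m _ F F0.
have [s cs|i ai Fi] := @chain_iter_Pop _ _ F; last by exists i.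
apply: contraT => /negP snc; case: (chain_Pl_zero cs); apply: F0.
by move=> /NC_ncmatching.
Qed.
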